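(* Let $d\ge 1$ be an integer and $p\in\{1,\ldots,2^{d-1}\}$. Then the constant $\kappa_{p,d}$ (the total constant generated by the order-reduction procedure described in the context, for any selection $S\subseteq\Xi_1$ with $|S|=p$) satisfies $$ \kappa_{p,d}=2^{\,d\cdot 2^{d-1}-p}. $$
   Context: For $\varphi\in\ell^2(\mathbb{Z}^d)$ let $(D_i\varphi)(\zeta):=\varphi(\zeta_1,\ldots,\zeta_i+1,\ldots,\zeta_d)-\varphi(\zeta_1,\ldots,\zeta_d)$, $i=1,\ldots,d$; these operators commute. Consider the $2^d$ formal terms $\|D_{a_1}\cdots D_{a_k}\varphi\|_{\ell^2(\mathbb{Z}^d)}$, one for each subset $\{a_1,\ldots,a_k\}$ of $\{1,\ldots,d\}$ (the empty subset giving $\|\varphi\|_{\ell^2(\mathbb{Z}^d)}$); terms are regarded as formal expressions, so different subsets give different terms. Let $\Xi_1$ be the set of the $2^{d-1}$ terms whose subset contains $1$, and $\Xi_2$ the set of the $2^{d-1}$ terms whose subset is contained in $\{2,\ldots,d\}$. The order $\tau(\xi)$ of a term $\xi$ is the number $k$ of difference operators in it. Order-reduction procedure: each elimination of one difference operator from a term costs a factor $2$ (by the bound $\|D_i\psi\|_{\ell^2(\mathbb{Z}^d)}\le 2\|\psi\|_{\ell^2(\mathbb{Z}^d)}$). Choose a subset $S\subseteq\Xi_1$ with $|S|=p$. Each $\xi\in S$ is reduced to $\|D_1\varphi\|_{\ell^2(\mathbb{Z}^d)}$, generating the factor $2^{\tau(\xi)-1}$; each $\xi\in\Xi_1\setminus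 S$ is reduced to $\|\varphi\|_{\ell^2(\mathbb{Z}^d)}$, generating the factor $2^{\tau(\xi)}$; each $\xi\in\Xi_2$ is reduced to $\|\varphi\|_{\ell^2(\mathbb{Z}^d)}$, generating the factor $2^{\tau(\xi)}$. The constant $\kappa_{p,d}$ is the product of all these factors, $$ \kappa_{p,d}:=\prod_{\xi\in S}2^{\tau(\xi)-1}\prod_{\xi\in\Xi_1\setminus S}2^{\tau(\xi)}\prod_{\xi\in\Xi_2}2^{\tau(\xi)} . $$ It is the constant in the resulting inequality $\|\varphi\|_{\ell^\infty(\mathbb{Z}^d)}^{2^d}\le\kappa_{p,d}\|D_1\varphi\|^{p}_{\ell^2(\mathbb{Z}^d)}\|\varphi\|^{2^d-p}_{\ell^2(\mathbb{Z}^d)}$. *)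

(* Defs.v *)
From mathcomp Require Import all_boot all_order all_algebra.

Set Implicit Arguments.
Unset Strict Implicit.
Unset Printing Implicit Defensive.

Import GRing.Theory Num.Theory.
Local Open Scope ring_scope.

(* The formal term ||D_{a_1} ... D_{a_k} phi|| is encoded by its subset of
   indices {a_1, ..., a_k}, with {1, ..., d} shifted to 'I_d = {0, ..., d-1}:
   the difference operator D_1 has index 0. *)
Definition term (d : nat) := {set 'I_d}.

Definition order_of (d : nat) (xi : term d) : nat := #|xi|.

Definition idx1 (d : nat) (hd : (0 < d)%N) : 'I_d := Ordinal hd.

Definition Xi1 (d : nat) (hd : (0 < d)%N) : {set term d} :=
  [set xi : term d | idx1 hd \in xi].

Definition Xi2 (d : nat) (hd : (0 < d)%N) : {set term d} :=
  [set xi : term d | xi \subset [set i : 'I_d | i != idx1 hd]].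

(* S is the set of terms of Xi1 that are reduced to ||D_1 phi||; all other
   terms are reduced to ||phi||. Exponents are integers, so that the
   subtraction is not truncated. *)
Definition kappa (R : realFieldType) (d : nat) (hd : (0 < d)%N)
    (S : {set term d}) : R :=
  (\prod_(xi in S) 2 ^ ((order_of xi)%:Z - 1))
  * (\prod_(xi in Xi1 hd :\: S) 2 ^ (order_of xi)%:Z)
  * (\prod_(xi in Xi2 hd) 2 ^ (order_of xi)%:Z).

(* Main.v *)
Require Import Defs.
From mathcomp Require Import all_boot all_order all_algebra.

(** Every term, wherever it is sent, contributes the factor [2 ^ order]; the
    only exception is that a term of [S] keeps one difference operator and so
    saves a single factor [2].  Hence [kappa] is [2 ^- p] times the product of
    [2 ^ order] over all terms ([prod_kept_operator]): the choice of [S] matters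
    only through its size, and [S], [Xi1 :\: S], [Xi2] partition the terms,
    that is, all subsets of the index set.  What remains is the total size of
    all subsets of a [d]-element set, which is [d * 2 ^ (d - 1)] because a
    subset and its complement together have [d] elements ([sum_card_set]). *)

Import GRing.Theory Num.Theory.
Local Open Scope ring_scope.

(** Pairing each subset with its complement counts the sum twice and turns it
    into a constant sum of [#|T|] over [2 ^ #|T|] subsets. *)
Lemma sum_card_set (T : finType) :
  (\sum_(A : {set T}) #|A| = #|T| * 2 ^ (#|T| - 1))%N.
Proof.
have twice : ((\sum_(A : {set T}) #|A|).*2 = #|T| * 2 ^ #|T|)%N.
  rewrite -addnn {2}(reindex_inj (@setC_inj T)) -big_split /=.
  under eq_bigr => A _ do rewrite cardsC.
  rewrite sum_nat_const mulnC; congr (_ * _)%N.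
  by rewrite -[in RHS]cardsT -card_powerset powersetT cardsT.
apply: double_inj; rewrite twice.
by case: #|T| => [|n]; rewrite ?mul0n // expnS subn1 -mul2n mulnCA.
Qed.

Lemma Xi2_setC (d : nat) (hd : (0 < d)%N) : Xi2 hd = ~: Xi1 hd.
Proof.
apply/setP => A; rewrite !inE.
apply/subsetP/idP => [sub | notin i iA].
  by apply/negP => /sub; rewrite inE eqxx.
by rewrite inE; apply: contraNneq notin => <-.
Qed.

(** The bookkeeping for the terms reduced to the norm of [D_1 phi]: each of
    them saves one factor [x], whatever its order. *)
Lemma prod_kept_operator (F : fieldType) (I : finType) (A : {set I})
    (f : I -> nat) (x : F) : x != 0 ->
  \prod_(i in A) x ^ ((f i)%:Z - 1)
    = (\prod_(i in A) x ^ (f i)%:Z) * x ^ (- #|A|%:Z).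
Proof.
move=> x0; under eq_bigr => i _ do rewrite expfzDr //.
by rewrite big_split /= prodr_const -exprnN -exprVn.
Qed.

Theorem theorem3p1 (R : realFieldType) (d p : nat) (hd : (0 < d)%N)
    (hp : (1 <= p <= 2 ^ (d - 1))%N)
    (S : {set term d}) (hS : S \subset Xi1 hd) (hSp : #|S| = p) :
  kappa R hd S = 2 ^ ((d * 2 ^ (d - 1))%N%:Z - p%:Z).
Proof.
have two_neq0 : (2 : R) != 0 by rewrite pnatr_eq0.
rewrite /kappa prod_kept_operator // hSp expfzDr //.
have -> : (2 : R) ^ (d * 2 ^ (d - 1))%N%:Z
    = \prod_(xi : term d) 2 ^ (order_of xi)%:Z.
  by rewrite prodrXr sum_card_set card_ord.
rewrite [in RHS](bigID (mem (Xi1 hd))) /= [in RHS](big_setID S) /= (setIidPr hS).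
have -> : \prod_(xi | xi \notin Xi1 hd) (2 : R) ^ (order_of xi)%:Z
    = \prod_(xi in Xi2 hd) 2 ^ (order_of xi)%:Z.
  by apply: eq_bigl => xi; rewrite Xi2_setC !inE.
rewrite -!mulrA; congr (_ * _).
by rewrite mulrC -mulrA.
Qed.
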